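(* Let $\mathfrak{H},\mathcal{K}$ be complex Hilbert spaces, $\omega\in\mathfrak{H}$ a distinguished unit vector, and let $\mathcal{E}$, $\pi$, $A^\ast_\eta$, $A_{\eta,n}$, $\phi$, $\psi$ be as defined in the context. Let $\eta$ be a unit vector of $\mathcal{K}$, let $b\in\pi(\mathcal{L}(\mathfrak{H}))$, and let $f(z)=\sum_{p=0}^{M}f_pz^p$ be a polynomial with complex coefficients. Put $A_{\eta,f^{\otimes}}=\sum_{p=0}^{M}f_pA_{\eta,p}$ and $$\alpha=b+A^\ast_\eta+A_{\eta,f^{\otimes}}\in\mathcal{L}(\mathcal{E}).$$ Then ${}^cR_\alpha(z)=z f(z)$, where ${}^cR_\alpha$ is taken with respect to the pair $(\phi,\psi)$.
   Context: $\mathcal{L}(V)$ denotes the bounded linear operators on a Hilbert space $V$; inner products are linear in the first variable. Space: $\mathcal{T}^0(\mathcal{K})=\bigoplus_{n\ge1}\mathcal{K}^{\otimes n}$, $\mathcal{T}(\mathcal{K})=\mathbb{C}\omega_1\oplus\mathcal{T}^0(\mathcal{K})$ with $\|\omega_1\|=1$; $\mathcal{E}=\mathfrak{H}\oplus(\mathfrak{H}\otimes\mathcal{T}(\mathcal{K}))$; $\mathfrak{H}^0=\mathfrak{H}\ominus\mathbb{C}\omega$; $\Omega=\omega\otimes\omega_1\in\mathfrak{H}\otimes\mathcal{T}(\mathcal{K})$. Functionals on $\mathcal{L}(\mathcal{E})$: $\phi(T)=\langle T\Omega,\Omega\rangle$ and $\psi(T)=\langle T\omega,\omega\rangle$, where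 in the latter $\omega$ is viewed in the first direct summand $\mathfrak{H}$ of $\mathcal{E}$. Embedding $\pi:\mathcal{L}(\mathfrak{H})\to\mathcal{L}(\mathcal{E})$: $\pi(a)$ acts as $a$ on the summand $\mathfrak{H}$, as $a\otimes\mathrm{Id}$ on $\mathfrak{H}\otimes\mathcal{T}^0(\mathcal{K})$, and as $0$ on $\mathfrak{H}\otimes\mathbb{C}\omega_1$. For nonzero $\eta\in\mathcal{K}$, $A^\ast_\eta\in\mathcal{L}(\mathcal{E})$ is given by $A^\ast_\eta\zeta=0$ for $\zeta\in\mathfrak{H}\oplus(\mathfrak{H}^0\otimes\mathcal{T}(\mathcal{K}))$, $A^\ast_\eta(\omega\otimes\omega_1)=\omega\otimes\eta$, $A^\ast_\eta(\omega\otimes\zeta)=\omega\otimes(\eta\otimes\zeta)$ for $\zeta\in\mathcal{T}^0(\mathcal{K})$. $A_{\eta,0}$ is the orthogonal projection onto $\mathbb{C}\Omega$; for $n\ge1$, $A_{\eta,n}(\omega\otimes\eta^{\otimes n})=\Omega$ and $A_{\eta,n}\zeta=0$ for $\zeta\perp\omega\otimes\eta^{\otimes n}$. ${}^cR$-transform: for $X\in\mathcal{L}(\mathcal{E})$ let $m_X(z)=\sum_{k\ge1}\psi(X^k)z^k$ and $M_X(z)=\sum_{k\ge1}\phi(X^k)z^k$ (formal power series). ${}^cR_X$ is the formal power series determined by $${}^cR_X\big(z[1+m_X(z)]\big)\cdot(1+M_X(z))=M_X(z)\,[1+m_X(z)].$$ *)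

(* Defs.v *)
From HB Require Import structures.
From mathcomp Require Import all_boot all_order all_algebra.
From mathcomp Require Import all_classical all_reals all_analysis.
From mathcomp Require Import sesquilinear complex.

Set Implicit Arguments.
Unset Strict Implicit.
Unset Printing Implicit Defensive.

Import Order.TTheory GRing.Theory Num.Theory.
Import numFieldNormedType.Exports.

Local Open Scope classical_set_scope.
Local Open Scope ring_scope.
Local Open Scope complex_scope.

(* Complex Hilbert spaces. In {dot V for _} the form is linear in its first
   argument and conjugate-linear in the second. *)
HB.mixin Record isHilbert (R : realType) V of CompleteNormedModule R[i] V := {
  inner : {dot V for @Num.conj R[i]};
  sqr_norm_inner : forall u : V, `|u| ^+ 2 = inner u u
}.

#[short(type="hilbertType")]
HB.structure Definition Hilbert (R : realType) :=
  {V of isHilbert R V & CompleteNormedModule R[i] V}.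

Notation "''[' u , v ]" := (inner u v) : ring_scope.

Definition bounded_operator (R : realType) (V W : hilbertType R)
    (T : V -> W) : Prop :=
  linear T /\ exists M : R[i], forall x, `|T x| <= M * `|x|.

Definition isometric (R : realType) (V W : hilbertType R) (T : V -> W) : Prop :=
  forall x y, '[T x, T y] = '[x, y].

Definition lin_span (R : realType) (V : hilbertType R) (S : set V) : set V :=
  [set v | exists n (c : 'I_n -> R[i]) (s : 'I_n -> V),
     (forall i, S (s i)) /\ v = \sum_(i < n) c i *: s i].

Definition total (R : realType) (V : hilbertType R) (S : set V) : Prop :=
  closure (lin_span S) = setT.

(* W, with the elementary tensors t u v, is the Hilbert space tensor product of
   U and V; this determines (W, t) up to a unique unitary. *)
Definition is_hilbert_tensor (R : realType) (U V W : hilbertType R)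
    (t : {bilinear U -> V -> W}) : Prop :=
  (forall u u' v v', '[t u v, t u' v'] = '[u, u'] * '[v, v']) /\
  total [set w | exists u v, w = t u v].

(* W is the Hilbert space direct sum of the V n, with inclusions j n. *)
Definition is_hilbert_sum (R : realType) (V : nat -> hilbertType R)
    (W : hilbertType R) (j : forall n, {linear V n -> W}) : Prop :=
  [/\ forall n, isometric (j n),
      forall m n, m <> n -> forall x y, '[j m x, j n y] = 0
    & total [set w | exists n x, w = j n x]].

(* The space E = H (+) (H (x) T(K)) together with the spaces it is built from.
   Tensor products and direct sums being defined up to unitary isomorphism,
   they are given by their structure maps rather than by a chosen model. *)
Record fock_space (R : realType) (H K : hilbertType R) := FockSpace {
  (* powK n is the tensor power of K of order n.+1 *)
  powK : nat -> hilbertType R;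
  powK1 : {linear K -> powK 0};
  powK1_iso : isometric powK1;
  powK1_surj : forall y, exists x, y = powK1 x;
  consK : forall n, {bilinear K -> powK n -> powK n.+1};
  consK_tensor : forall n, is_hilbert_tensor (consK n);
  (* fock0 = T^0(K) *)
  fock0 : hilbertType R;
  inj0 : forall n, {linear powK n -> fock0};
  inj0_sum : is_hilbert_sum inj0;
  (* fock = T(K) = C vac (+) T^0(K) *)
  fock : hilbertType R;
  vac : fock;
  inj1 : {linear fock0 -> fock};
  vac_norm : `|vac| = 1;
  inj1_iso : isometric inj1;
  vac_orth : forall x, '[vac, inj1 x] = 0;
  fock_dec : forall y, exists c x, y = c *: vac + inj1 x;
  (* tensHF = H (x) T(K) *)
  tensHF : hilbertType R;
  tens : {bilinear H -> fock -> tensHF};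
  tens_tensor : is_hilbert_tensor tens;
  (* space = E = H (+) (H (x) T(K)) *)
  space :> hilbertType R;
  injH : {linear H -> space};
  injHF : {linear tensHF -> space};
  injH_iso : isometric injH;
  injHF_iso : isometric injHF;
  injH_injHF_orth : forall h x, '[injH h, injHF x] = 0;
  space_dec : forall y, exists h x, y = injH h + injHF x
}.

Section Operators.
Variables (R : realType) (H K : hilbertType R) (E : fock_space H K).

(* eta ^ (x) n.+1 *)
Fixpoint tpow (eta : K) (n : nat) : powK E n :=
  if n is n'.+1 then consK E n' eta (tpow eta n') else powK1 E eta.

Definition inK n (x : powK E n) : fock E := inj1 E (inj0 E n x).

(* h (x) z, seen in E *)
Definition etens (h : H) (z : fock E) : E := injHF E (tens E h z).

Definition Omega (w : H) : E := etens w (vac E).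

(* T = pi a *)
Definition is_pi (a : H -> H) (T : E -> E) : Prop :=
  [/\ bounded_operator T,
      forall h, T (injH E h) = injH E (a h),
      forall h z, T (etens h (inj1 E z)) = etens (a h) (inj1 E z)
    & forall h, T (etens h (vac E)) = 0].

Definition range_pi : set (E -> E) :=
  [set T | exists2 a : H -> H, bounded_operator a & is_pi a T].

(* T = A^*_eta. The product eta (x) z with z in T^0(K) is only spelled out for
   z in a tensor power of K: both sides are linear and continuous in z. *)
Definition is_creation (w : H) (eta : K) (T : E -> E) : Prop :=
  [/\ bounded_operator T,
      forall h, T (injH E h) = 0,
      forall h z, '[h, w] = 0 -> T (etens h z) = 0,
      T (etens w (vac E)) = etens w (@inK 0 (powK1 E eta))
    & forall n (z : powK E n),
        T (etens w (inK z)) = etens w (inK (consK E n eta z))].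

(* T = A_{eta,n} *)
Definition is_annihilation (w : H) (eta : K) (n : nat) (T : E -> E) : Prop :=
  bounded_operator T /\
  match n with
  | 0 => T (Omega w) = Omega w /\
         forall z, '[z, Omega w] = 0 -> T z = 0
  | n'.+1 => T (etens w (inK (tpow eta n'))) = Omega w /\
             forall z, '[z, etens w (inK (tpow eta n'))] = 0 -> T z = 0
  end.

Definition phi (w : H) (T : E -> E) : R[i] := '[T (Omega w), Omega w].

Definition psi (w : H) (T : E -> E) : R[i] := '[T (injH E w), injH E w].

End Operators.

(* Formal power series over C, as their sequences of coefficients. The pointwise
   ring structure of nat -> R[i] provides the sum, but neither the product nor
   the unit. *)
Section PowerSeries.
Variable R : realType.
Implicit Types F G : nat -> R[i].

Definition ps_one : nat -> R[i] := fun n => (n == 0%N)%:R.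

Definition ps_var : nat -> R[i] := fun n => (n == 1%N)%:R.

Definition ps_mul F G : nat -> R[i] :=
  fun n => \sum_(i < n.+1) F i * G (n - i)%N.

Definition ps_exp F (k : nat) : nat -> R[i] := iter k (ps_mul F) ps_one.

(* F(G(z)), meaningful when G 0 = 0: the coefficient of z^n in G^k is then 0
   for n < k. *)
Definition ps_comp F G : nat -> R[i] :=
  fun n => \sum_(k < n.+1) F k * ps_exp G k n.

End PowerSeries.

Arguments ps_one {R}.
Arguments ps_var {R}.

Section RTransform.
Variables (R : realType) (H K : hilbertType R) (E : fock_space H K) (w : H).

(* m_X and M_X *)
Definition psi_moments (X : E -> E) : nat -> R[i] :=
  fun k => if k == 0%N then 0 else psi w (iter k X).

Definition phi_moments (X : E -> E) : nat -> R[i] :=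
  fun k => if k == 0%N then 0 else phi w (iter k X).

Definition cR_equation (X : E -> E) (F : nat -> R[i]) : Prop :=
  let m := psi_moments X in
  let M := phi_moments X in
  ps_mul (ps_comp F (ps_mul ps_var (ps_one + m))) (ps_one + M) =
  ps_mul M (ps_one + m).

(* The equation has exactly one solution, because z (1 + m_X(z)) = z + O(z^2)
   and 1 + M_X(z) is invertible; the default value is never used. *)
Definition cR (X : E -> E) : nat -> R[i] :=
  xget (fun=> 0) [set F | cR_equation X F].

End RTransform.

(* Main.v *)
(** The vectors [alpha^k Omega] stay in the span of the [h (x) eta^n]. If
    [h_n(z)] generates their components along [eta^n] and
    [g_n(z) = <h_n(z), omega>], then [h_(n+1)(z) = z g_n(z) (1 - z a)^-1 omega],
    so [g_(n+1) = G g_n] with [G = z (1 + m)], and [g_0 = 1 + M] gives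
    [g_n = G^n (1 + M)]. The annihilation operators return [f_n g_n] to [Omega],
    whence [M = z f(G) (1 + M)]; multiplying by [1 + m] gives the equation of
    the cR-transform for [z f(z)]. *)

Require Import Defs.
From HB Require Import structures.
From mathcomp Require Import all_boot all_order all_algebra.
From mathcomp Require Import all_classical all_reals all_analysis.
From mathcomp Require Import sesquilinear complex.

Set Implicit Arguments.
Unset Strict Implicit.
Unset Printing Implicit Defensive.

Import Order.TTheory GRing.Theory Num.Theory.
Import numFieldNormedType.Exports.

Local Open Scope classical_set_scope.
Local Open Scope ring_scope.
Local Open Scope complex_scope.

(** Past [size f] the coefficients vanish and past [n] the values of [u] do, so either cut-off can
    replace the other. *)
Lemma sum_coef_poly (R : pzRingType) (f : seq R) (u : nat -> R) n :
  (forall p, (n <= p)%N -> u p = 0) ->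
  \sum_(p < n) f`_p * u p = \sum_(p < size f) f`_p * u p.
Proof.
move=> u0; pose v p := f`_p * u p.
rewrite (big_ord_widen_cond (maxn n (size f)) xpredT v) ?leq_maxl //.
rewrite [RHS](big_ord_widen_cond (maxn n (size f)) xpredT v) ?leq_maxr //.
rewrite /v big_mkcond [RHS]big_mkcond; apply: eq_bigr => p _ /=.
case: ltnP => np; case: ltnP => fp //; first by rewrite nth_default ?mul0r.
by rewrite u0 ?mulr0.
Qed.

(** * Algebra of formal power series *)

Section PowerSeriesTheory.
Variable R : realType.
Implicit Types F G L : nat -> R[i].

(** A coefficient of a product only sees truncations, so the ring laws can be inherited from
    polynomials. *)
Lemma ps_mulE N F G n : (n < N)%N ->
  ps_mul F G n = (\poly_(i < N) F i * \poly_(i < N) G i)`_n.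
Proof.
move=> nN; rewrite coefM; apply: eq_bigr => i _.
have iN : (i < N)%N := leq_trans (ltn_ord i) nN.
by rewrite !coef_poly iN (leq_ltn_trans (leq_subr _ _) nN).
Qed.

Lemma ps_mulC F G : ps_mul F G = ps_mul G F.
Proof. by apply/funext => n; rewrite !(ps_mulE _ _ (ltnSn n)) mulrC. Qed.

Lemma ps_mulA F G L : ps_mul F (ps_mul G L) = ps_mul (ps_mul F G) L.
Proof.
apply/funext => n; transitivity
  ((\poly_(i < n.+1) F i * (\poly_(i < n.+1) G i * \poly_(i < n.+1) L i))`_n).
  rewrite coefM; apply: eq_bigr => i _.
  by rewrite coef_poly ltn_ord (@ps_mulE n.+1) // ltnS leq_subr.
rewrite mulrA coefM; apply: eq_bigr => i _.
by rewrite coef_poly ltnS leq_subr (ps_mulE _ _ (ltn_ord i)).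
Qed.

Lemma ps_mul1 F : ps_mul ps_one F = F.
Proof.
apply/funext => n; rewrite /ps_mul big_ord_recl subn0 mul1r big1 ?addr0 // => i _.
by rewrite mul0r.
Qed.

Lemma ps_mul_var0 F : ps_mul ps_var F 0%N = 0.
Proof. by rewrite /ps_mul big_ord1 mul0r. Qed.

Lemma ps_mul_varS F n : ps_mul ps_var F n.+1 = F n.
Proof.
rewrite /ps_mul !big_ord_recl mul0r add0r mul1r subSS subn0 big1 ?addr0 // => i _.
by rewrite mul0r.
Qed.

Lemma ps_mul_suml N (c : nat -> R[i]) (F : nat -> nat -> R[i]) G :
  ps_mul (fun n => \sum_(p < N) c p * F p n) G =
  fun n => \sum_(p < N) c p * ps_mul (F p) G n.
Proof.
apply/funext => n; rewrite /ps_mul.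
under eq_bigr do rewrite big_distrl.
rewrite exchange_big; apply: eq_bigr => p _ /=.
by rewrite big_distrr; apply: eq_bigr => i _ /=; rewrite mulrA.
Qed.

(** Each factor without constant term raises the order by at least one. *)
Lemma ps_exp_lt F k n : F 0%N = 0 -> (n < k)%N -> ps_exp F k n = 0.
Proof.
move=> F0; elim: k n => // k IH n nk; rewrite /ps_exp iterS /ps_mul big1 // => i _.
have [->|i0] := posnP i; first by rewrite F0 mul0r.
rewrite -/(ps_exp F k) IH ?mulr0 // -ltnS; apply: leq_trans nk.
by rewrite ltnS ltn_subrL i0 (leq_trans i0 (leq_ord i)).
Qed.

Lemma ps_exp_diag F n : F 0%N = 0 -> F 1%N = 1 -> ps_exp F n n = 1.
Proof.
move=> F0 F1; elim: n => // n IH.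
rewrite /ps_exp iterS -/(ps_exp F n) /ps_mul !big_ord_recl F0 mul0r add0r F1 mul1r.
rewrite subSS subn0 IH big1 ?addr0 // => i _.
by rewrite ps_exp_lt ?mulr0 // subSS ltn_subrL (leq_ltn_trans _ (ltn_ord i)).
Qed.

Lemma ps_mul_injl C F G : C 0%N = 1 -> ps_mul F C = ps_mul G C -> F = G.
Proof.
move=> C0 eqFG; apply/funext => n; elim/ltn_ind: n => n IH.
have /(congr1 (fun h => h n)) := eqFG.
rewrite /ps_mul !big_ord_recr /= subnn C0 !mulr1.
rewrite (eq_bigr (fun i : 'I_n => G i * C (n - i)%N)); first exact: addrI.
by move=> i _; rewrite IH.
Qed.

(** The coefficients of [F] solve a triangular system whose diagonal entries, those of [z^n] in
    [L^n], are all 1. *)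
Lemma ps_comp_injl L F G : L 0%N = 0 -> L 1%N = 1 ->
  ps_comp F L = ps_comp G L -> F = G.
Proof.
move=> L0 L1 eqFG; apply/funext => n; elim/ltn_ind: n => n IH.
have /(congr1 (fun h => h n)) := eqFG.
rewrite /ps_comp !big_ord_recr /= ps_exp_diag // !mulr1.
rewrite (eq_bigr (fun i : 'I_n => G i * ps_exp L i n)); first exact: addrI.
by move=> i _; rewrite IH.
Qed.

(** This is [(z f)(L) = f(L) L]; terms with [p >= n] do not reach degree [n], since [L^(p+1)] has
    order at least [p+1]. *)
Lemma ps_comp_mulX (f : {poly R[i]}) L : L 0%N = 0 ->
  ps_comp (fun n => ('X * f)`_n) L =
  ps_mul (fun n => \sum_(p < size f) f`_p * ps_exp L p n) L.
Proof.
move=> L0; rewrite ps_mul_suml; apply/funext => n.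
rewrite /ps_comp big_ord_recl coefXM mul0r add0r.
under eq_bigr => i _ do rewrite lift0 coefXM /=.
under [RHS]eq_bigr => i _ do rewrite ps_mulC -[ps_mul L _]/(ps_exp L i.+1).
apply: (sum_coef_poly f (u := fun p => ps_exp L p.+1 n)) => p np.
exact: ps_exp_lt.
Qed.

End PowerSeriesTheory.

(** * Action of the three kinds of operators on the vectors [h (x) eta^n] *)

Section FockVectors.
Variables (R : realType) (H K : hilbertType R) (E : fock_space H K).
Variables (w : H) (eta : K).
Hypotheses (w_unit : `|w| = 1) (eta_unit : `|eta| = 1).

(** The power [eta^n] inside [T(K)], from the vacuum on; the shift is needed because [tpow] starts
    at order one. *)
Definition fpow n : fock E :=
  if n is n'.+1 then inK (tpow E eta n') else vac E.

Definition ev n (h : H) : E := etens h (fpow n).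

Lemma evP n c h k : ev n (c *: h + k) = c *: ev n h + ev n k.
Proof. by rewrite /ev /etens linearDl linearZl_LR linearD linearZ. Qed.

Lemma OmegaE h : Omega E h = ev 0 h.
Proof. by []. Qed.

Lemma ev0 n : ev n 0 = 0.
Proof. by rewrite /ev /etens linear0l linear0. Qed.

Lemma evZ n c h : ev n (c *: h) = c *: ev n h.
Proof. by rewrite -[c *: h]addr0 evP ev0 addr0. Qed.

Lemma inner_unit (V : hilbertType R) (v : V) : `|v| = 1 -> '[v, v] = 1.
Proof. by move=> v1; rewrite -sqr_norm_inner v1 expr1n. Qed.

Lemma inner_tpow n : '[tpow E eta n, tpow E eta n] = 1.
Proof.
elim: n => [|n IH] /=; first by rewrite powK1_iso inner_unit.
by have [-> _] := consK_tensor E n; rewrite IH inner_unit // mulr1.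
Qed.

Lemma inner_fpow m n : '[fpow m, fpow n] = (m == n)%:R.
Proof.
have [j_iso j_orth _] := inj0_sum E.
case: m n => [|m] [|n] /=.
- by rewrite inner_unit ?vac_norm.
- by rewrite /inK vac_orth.
- by apply/eqP; rewrite herm_eq0C; apply/eqP; exact: vac_orth.
rewrite /inK inj1_iso eqSS; case: eqVneq => [<-|/eqP mn].
  by rewrite j_iso inner_tpow.
by rewrite j_orth.
Qed.

Lemma inner_ev m n h k : '[ev m h, ev n k] = '[h, k] * (m == n)%:R.
Proof.
rewrite /ev /etens injHF_iso; have [-> _] := tens_tensor E.
by rewrite inner_fpow.
Qed.

Lemma inner_sub_proj (V : hilbertType R) (v e : V) : '[e, e] = 1 ->
  '[v - '[v, e] *: e, e] = 0.
Proof. by move=> e1; rewrite linearBl linearZl_LR /= e1 mulr1 subrr. Qed.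

(* Subtracting the component of [v] along [e] leaves a vector killed by [T]. *)
Lemma rank1 (V W : hilbertType R) (T : V -> W) (v e : V) : linear T ->
  '[e, e] = 1 -> (forall z, '[z, e] = 0 -> T z = 0) -> T v = '[v, e] *: T e.
Proof.
move=> T_lin e1 T0; have {1}-> : v = '[v, e] *: e + (v - '[v, e] *: e).
  by rewrite addrC subrK.
by rewrite T_lin [T (_ - _)]T0 ?addr0 // inner_sub_proj.
Qed.

Lemma annihilation_ev p (T : E -> E) n h : is_annihilation w eta p T ->
  T (ev n h) = ('[h, w] * (n == p)%:R) *: Omega E w.
Proof.
have e1 : '[ev p w, ev p w] = 1 by rewrite inner_ev inner_unit ?eqxx ?mulr1.
(* As [ev 0 w] is [Omega], both cases of the definition say the same about the unit vector
   [ev p w]. *)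
move=> [[T_lin _] Tp]; have [Te T0] : T (ev p w) = Omega E w /\
  forall z, '[z, ev p w] = 0 -> T z = 0 by case: p Tp {e1}.
by rewrite (rank1 _ T_lin e1 T0) Te inner_ev.
Qed.

(** The part of [h] orthogonal to [w] is killed, so only its component along [w] is raised. *)
Lemma creation_ev (T : E -> E) n h : is_creation w eta T ->
  T (ev n h) = '[h, w] *: ev n.+1 w.
Proof.
move=> [[T_lin _] _ T0 T_vac T_cons].
have -> : ev n h = '[h, w] *: ev n w + ev n (h - '[h, w] *: w).
  by rewrite -evP addrC subrK.
rewrite T_lin [T (ev _ (_ - _))]T0 ?inner_sub_proj ?inner_unit // addr0.
by congr (_ *: _); case: n => [|n]; [exact: T_vac | exact: T_cons].
Qed.

Lemma pi_ev (a : H -> H) (T : E -> E) n h : is_pi a T ->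
  T (ev n h) = if n is 0%N then 0 else ev n (a h).
Proof. by move=> [_ _ T_fock T_vac]; case: n => [|n]; [exact: T_vac | exact: T_fock]. Qed.

End FockVectors.

(** * Moments of [alpha] and its cR-transform *)

Section Alpha.
Variables (R : realType) (H K : hilbertType R) (E : fock_space H K).
Variables (w : H) (eta : K).
Hypotheses (w_unit : `|w| = 1) (eta_unit : `|eta| = 1).
Variables (a : H -> H) (b Astar : E -> E) (A : nat -> E -> E) (f : {poly R[i]}).
Hypotheses (a_bounded : bounded_operator a) (b_pi : is_pi a b).
Hypothesis Astar_creation : is_creation w eta Astar.
Hypothesis A_annihilation : forall n, is_annihilation w eta n (A n).

Local Notation ev := (@ev R H K E eta).
Let alpha : E -> E := b + Astar + \sum_(p < size f) f`_p *: A p.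

Lemma alphaE x : alpha x = b x + Astar x + \sum_(p < size f) f`_p *: A p x.
Proof. by rewrite /alpha fct_sumE. Qed.

Lemma alpha_linear : linear alpha.
Proof.
move=> c x y; rewrite !alphaE.
have [[-> _] _ _ _] := b_pi; have [[-> _] _ _ _ _] := Astar_creation.
rewrite !scalerDr scaler_sumr [RHS]addrACA [X in _ = X + _]addrACA; congr (_ + _).
rewrite -big_split; apply: eq_bigr => p _.
have [[-> _] _] := A_annihilation p.
by rewrite scalerDr !scalerA mulrC.
Qed.

(** The first summand is orthogonal to every [w (x) eta^n], so only [b] acts there; hence [psi] sees
    the moments of [a]. *)
Lemma alpha_injH h : alpha (injH E h) = injH E (a h).
Proof.
rewrite alphaE; have [_ -> _ _] := b_pi; have [_ -> _ _ _] := Astar_creation.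
rewrite addr0 big1 ?addr0 // => p _.
have [_ Ap] := A_annihilation p; case: (nat_of_ord p) Ap => [|p'] [_ ->];
  by rewrite ?scaler0 // /Omega /etens injH_injHF_orth.
Qed.

Lemma iter_alpha_injH k : iter k alpha (injH E w) = injH E (iter k a w).
Proof. by elim: k => // k IH; rewrite !iterS IH alpha_injH. Qed.

(** Among the annihilation operators only [A n] detects [eta^n], and [b] kills the vacuum level. *)
Lemma alpha_ev n h : alpha (ev n h) =
  (if n is 0%N then 0 else ev n (a h)) + '[h, w] *: ev n.+1 w +
  (f`_n * '[h, w]) *: ev 0 w.
Proof.
rewrite alphaE (pi_ev _ _ _ b_pi) (creation_ev w_unit _ _ Astar_creation).
congr (_ + _).
under eq_bigr => p _ do
  rewrite (annihilation_ev w_unit eta_unit _ _ (A_annihilation p)) scalerA.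
rewrite -scaler_suml; congr (_ *: _).
have [nf|fn] := ltnP n (size f).
  rewrite (bigD1 (Ordinal nf)) //= eqxx mulr1 big1 ?addr0 // => p pn.
  by rewrite eq_sym (negbTE (_ : (p != n :> nat))) ?mulr0.
rewrite [in RHS]nth_default // mul0r big1 // => p _.
by rewrite (gtn_eqF (leq_trans (ltn_ord p) fn)) !mulr0.
Qed.

(* [alpha^k Omega] is the sum over [n] of the [fock_coef k n] (x) [eta^n]. *)
Fixpoint fock_coef k : nat -> H :=
  if k is k'.+1 then fun n =>
    if n is n'.+1 then '[fock_coef k' n', w] *: w + a (fock_coef k' n)
    else (\sum_(p < size f) f`_p * '[fock_coef k' p, w]) *: w
  else fun n => if n is 0%N then w else 0.

Let a_lin : linear a := a_bounded.1.

Lemma a0 : a 0 = 0.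
Proof. by have /eqP := a_lin (-1) 0 0; rewrite !scaleN1r oppr0 addr0 addNr => /eqP. Qed.

(** One application of [alpha] raises the tensor degree by at most one. *)
Lemma fock_coef_gt k n : (k < n)%N -> fock_coef k n = 0.
Proof.
elim: k n => [|k IH] [|n] //=; rewrite ltnS => kn.
by rewrite !IH ?a0 ?linear0l ?scale0r ?addr0 // ltnW.
Qed.

Lemma iter_alpha_Omega k :
  iter k alpha (Omega E w) = \sum_(n < k.+1) ev n (fock_coef k n).
Proof.
pose al : {linear E -> E} := HB.pack alpha (GRing.isLinear.Build _ _ _ _ _ alpha_linear).
elim: k => [|k IH]; first by rewrite big_ord1.
rewrite iterS IH -[alpha]/(al : E -> E) linear_sum.
under eq_bigr => n _ do rewrite /= alpha_ev.
rewrite big_split /= [RHS]big_ord_recl /= evZ addrC.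
congr (_ + _).
  rewrite -scaler_suml; congr (_ *: _).
  apply: (sum_coef_poly f (u := fun p => '[fock_coef k p, w])) => p kp.
  by rewrite fock_coef_gt ?linear0l.
rewrite big_split /= addrC [X in _ + X]big_ord_recl add0r.
under [RHS]eq_bigr => n _ do rewrite evP.
rewrite [RHS]big_split; congr (_ + _).
(* The extra top term is the image under [a] of the degree [k.+1] component of [alpha^k Omega],
   which is zero. *)
by rewrite [RHS]big_ord_recr /= fock_coef_gt // a0 ev0 addr0.
Qed.

Lemma psi_momentsE : ps_one + psi_moments w alpha = fun k => '[iter k a w, w].
Proof.
apply/funext => -[|k]; rewrite -[LHS]/(_ + _) /psi_moments /ps_one /=.
  by rewrite addr0 inner_unit.
by rewrite add0r /psi -iterS iter_alpha_injH injH_iso.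
Qed.

Lemma phi_momentsE : ps_one + phi_moments w alpha = fun k => '[fock_coef k 0, w].
Proof.
apply/funext => k.
have -> : (ps_one + phi_moments w alpha) k = phi w (iter k alpha).
  rewrite -[LHS]/(_ + _) /phi_moments /ps_one /=; case: k => [|k] /=; last exact: add0r.
  by rewrite addr0 /phi (OmegaE E eta) inner_ev // eqxx mulr1 inner_unit.
rewrite /phi iter_alpha_Omega (OmegaE E eta) big_ord_recl linearDl /=.
rewrite inner_ev // mulr1 linear_sumlz /= big1 ?addr0 // => n _.
by rewrite inner_ev // mulr0.
Qed.

(** Unrolling the recursion in [k]: each passage from level [n] to [n.+1] restarts at [w], and [a]
    acts from then on. *)
Lemma fock_coefS k n :
  fock_coef k n.+1 = \sum_(i < k) '[fock_coef i n, w] *: iter (k.-1 - i) a w.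
Proof.
pose al : {linear H -> H} := HB.pack a (GRing.isLinear.Build _ _ _ _ _ a_lin).
elim: k => [|k IH] /=; first by rewrite big_ord0.
rewrite IH big_ord_recr /= subnn addrC; congr (_ + _).
rewrite -[a (\sum_(i < k) _)]/(al _) linear_sum; apply: eq_bigr => i _.
rewrite linearZ /= -iterS; congr (_ *: iter _ a w).
by case: k i {IH} => [[]//|k] i /=; rewrite subSn ?leq_ord.
Qed.

(* The resolvent identity [h_(n+1)(z) = z g_n(z) (1 - z a)^-1 w] of
   the header, paired with [w]. *)
Lemma inner_fock_coef n : (fun k => '[fock_coef k n, w]) =
  ps_mul (ps_exp (ps_mul ps_var (ps_one + psi_moments w alpha)) n)
         (ps_one + phi_moments w alpha).
Proof.
set G := ps_mul ps_var _; elim: n => [|n IH]; first by rewrite ps_mul1 phi_momentsE.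
rewrite /ps_exp iterS -/(ps_exp G n) -ps_mulA -IH ps_mulC.
apply/funext => k; rewrite fock_coefS linear_sumlz /ps_mul.
(* The convolution has one term more than [fock_coefS]; it vanishes because [G] has no constant
   term. *)
rewrite big_ord_recr subnn /= [G 0%N]ps_mul_var0 mulr0 addr0.
apply: eq_bigr => i _; rewrite linearZl_LR; congr (_ * _).
case: k i => [[]//|k] i; rewrite subSn ?leq_ord //.
by rewrite [G _]ps_mul_varS psi_momentsE.
Qed.

Lemma cR_alpha : cR w alpha = fun n => ('X * f)`_n.
Proof.
pose m1 := ps_one + psi_moments w alpha; pose G := ps_mul ps_var m1.
pose M1 := ps_one + phi_moments w alpha.
pose S n := \sum_(p < size f) f`_p * ps_exp G p n.
have G0 : G 0%N = 0 by exact: ps_mul_var0.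
have G1 : G 1%N = 1 by rewrite [LHS]ps_mul_varS /m1 psi_momentsE inner_unit.
have M0 : M1 0%N = 1 by rewrite /M1 phi_momentsE inner_unit.
(* Here [S] is [f(G)]: the vacuum component of [alpha^(k+1) Omega] collects the [f_p g_p] at step
   [k], and [g_p = G^p (1 + M)]. *)
have M_eq : phi_moments w alpha = ps_mul ps_var (ps_mul S M1).
  apply/funext => -[|k]; first by rewrite ps_mul_var0.
  rewrite ps_mul_varS ps_mul_suml.
  under eq_bigr => p _ do rewrite -[ps_mul _ _]inner_fock_coef.
  transitivity (M1 k.+1); first by rewrite [RHS]add0r.
  by rewrite /M1 phi_momentsE /= linearZl_LR /= (inner_unit w_unit) // mulr1.
have Xf_eq : cR_equation w alpha (fun n => ('X * f)`_n).
  rewrite /cR_equation -/m1 -/M1 -/G ps_comp_mulX // -/S.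
  by rewrite [in RHS]M_eq [RHS]ps_mulC ps_mulA (ps_mulC m1) -/G ps_mulA (ps_mulC S).
(* For uniqueness, cancel [1 + M], whose constant term is 1, then the composition with
   [G = z + O(z^2)]. *)
apply: xget_unique => // F F_eq; apply: (ps_comp_injl G0 G1).
exact: (ps_mul_injl M0) (etrans F_eq (esym Xf_eq)).
Qed.

End Alpha.

Theorem theorem3p1 (R : realType) (H K : hilbertType R) (w : H)
    (w_unit : `|w| = 1) (E : fock_space H K)
    (eta : K) (eta_unit : `|eta| = 1)
    (b : E -> E) (b_pi : range_pi b)
    (Astar : E -> E) (Astar_creation : is_creation w eta Astar)
    (A : nat -> E -> E) (A_annihilation : forall n, is_annihilation w eta n (A n))
    (f : {poly R[i]}) :
  let alpha : E -> E := b + Astar + \sum_(p < size f) f`_p *: A p in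
  cR w alpha = fun n => ('X * f)`_n.
Proof.
case: b_pi => a a_bounded pi_b.
exact: (cR_alpha w_unit eta_unit f a_bounded pi_b Astar_creation A_annihilation).
Qed.
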